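(* Let $X$ and $Y$ be higher-dimensional automata. Then $X$ and $Y$ are homotopy bisimilar if and only if they are hd-bisimilar.
   Context: A precubical set $X$ is a family of pairwise disjoint sets $(X_n)_{n\ge 0}$ (elements of $X_n$ are $n$-cubes, $\dim x=n$) together with face maps $\delta_k^\nu:X_n\to X_{n-1}$ ($n\ge1$, $1\le k\le n$, $\nu\in\{0,1\}$) satisfying $\delta_k^\nu\delta_\ell^\mu=\delta_{\ell-1}^\mu\delta_k^\nu$ for $k<\ell$. A morphism $f:X\to Y$ is a family of maps $f_n:X_n\to Y_n$ commuting with all face maps. A higher-dimensional automaton (HDA) is a precubical set $X$ with a distinguished $0$-cube $i\in X_0$; the category $\mathsf{HDA}$ has HDA as objects and point-preserving precubical morphisms as morphisms. A cube path in a precubical set $X$ is a finite sequence $(x_1,\dots,x_m)$ of elements of $X$ such that for each $j<m$ there is $k$ with $x_j=\delta_k^0x_{j+1}$ or $x_{j+1}=\delta_k^1x_j$; it is pointed if $x_1=i$. A precubical path object is a precubical set $P$ for which there is a sequence $(p_1,\dots,p_m)$ of pairwise distinct elements that is a cube path and such that every element of $P$ equals $\delta_{k_1}^{\nu_1}\cdots\delta_{k_s}^{\nu_s}p_j$ for some $j$, some $\nu_1,\dots,\nu_s$ and a unique sequence $k_1<\dots<k_s$ (such a sequence is unique); it is pointed at $p_1$. For path objects with sequences $(p_1,\dots,p_m)$, $(q_1,\dots,q_r)$, a morphism $g:P\to Q$ is a cube path extension if $g(p_j)=q_j$ for $j=1,\dots,m$. $\mathsf{HDP}$ is the subcategory of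 $\mathsf{HDA}$ whose objects are pointed precubical path objects and whose morphisms are generated by pointed cube path extensions and isomorphisms. A morphism $f:X\to Y$ of $\mathsf{HDA}$ is open if for all $g:P\to Q$ in $\mathsf{HDP}$ and $p:P\to X$, $q:Q\to Y$ in $\mathsf{HDA}$ with $f\circ p=q\circ g$ there is $r:Q\to X$ in $\mathsf{HDA}$ with $r\circ g=p$, $f\circ r=q$. HDA $X,Y$ are hd-bisimilar if there are an HDA $Z$ and open morphisms $Z\to X$, $Z\to Y$ in $\mathsf{HDA}$. Homotopy: two cube paths $(x_1,\dots,x_m)$, $(y_1,\dots,y_m)$ are adjacent if $x_1=y_1$, $x_m=y_m$, there is exactly one index $p$ with $x_p\ne y_p$, and for some $k<\ell$ one of the following holds, or holds with the roles of the two paths interchanged: (i) $x_{p-1}=\delta_k^0x_p$, $x_p=\delta_\ell^0x_{p+1}$, $y_{p-1}=\delta_{\ell-1}^0y_p$, $y_p=\delta_k^0y_{p+1}$; (ii) $x_p=\delta_k^1x_{p-1}$, $x_{p+1}=\delta_\ell^1x_p$, $y_p=\delta_{\ell-1}^1y_{p-1}$, $y_{p+1}=\delta_k^1y_p$; (iii) $x_p=\delta_k^0\delta_\ell^1y_p$, $y_{p-1}=\delta_k^0y_p$, $y_{p+1}=\delta_\ell^1y_p$; (iv) $x_p=\delta_k^1\delta_\ell^0y_p$, $y_{p-1}=\delta_\ell^0y_p$, $y_{p+1}=\delta_k^1y_p$. Homotopy $\sim$ is the reflexive transitive closure of adjacency; $[x_1,\dots,x_m]$ denotes a homotopy class. Unfolding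 of an HDA $(X,i)$: $\tilde X_n$ is the set of homotopy classes $[x_1,\dots,x_m]$ of pointed cube paths with $x_m\in X_n$, with point $[i]$, face maps $\tilde\delta_k^1[x_1,\dots,x_m]=[x_1,\dots,x_m,\delta_k^1x_m]$ and $\tilde\delta_k^0[x_1,\dots,x_m]=\{(y_1,\dots,y_p)\mid y_p=\delta_k^0x_m,\ (y_1,\dots,y_p,x_m)\sim(x_1,\dots,x_m)\}$; this is an HDA, and $\pi_X:\tilde X\to X$, $\pi_X[x_1,\dots,x_m]=x_m$, is a pointed morphism. An HDA is a higher-dimensional tree if for each of its cubes $x$ there is exactly one homotopy class of pointed cube paths to $x$; for trees $\pi_X$ is an isomorphism. The category $\mathsf{HDA}_h$ has HDA as objects; a morphism $X\to Y$ is a pointed precubical morphism $\tilde X\to\tilde Y$ (composition as maps). $\mathsf{HDP}_h$ is the subcategory of $\mathsf{HDA}_h$ with the objects of $\mathsf{HDP}$ and morphisms $P\to Q$ the maps $\pi_Q^{-1}\circ g\circ\pi_P:\tilde P\to\tilde Q$ for $g:P\to Q$ in $\mathsf{HDP}$. A morphism $f$ of $\mathsf{HDA}_h$ is open if it has the right lifting property (as in the definition of open above, but with all morphisms in $\mathsf{HDA}_h$) with respect to all morphisms of $\mathsf{HDP}_h$. HDA $X,Y$ are homotopy bisimilar if there are an HDA $Z$ and open morphisms $Z\to X$, $Z\to Y$ in $\mathsf{HDA}_h$.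
   Formalization: Adjacency (ii) has l and l-1 interchanged; path objects in HDP must be trees, so that pi_Q is invertible; since a lower face set in the unfolding may be a union of several homotopy classes, morphisms of unfoldings send each class contained in a face set to one contained in the image's face set. *)

(* Defs.v *)
From Stdlib Require Import Relation_Operators.
From Stdlib Require List Eqdep_dec PeanoNat.
From mathcomp Require Import all_boot.
From mathcomp Require Import boolp classical_sets.

Set Implicit Arguments.
Unset Strict Implicit.
Unset Printing Implicit Defensive.

Local Open Scope classical_set_scope.

(* Face indices are counted from 0 and [nu = false], [true] stand for lower and
   upper faces: [face k false] is the map written delta_{k+1}^0 when indices
   are counted from 1. *)
Record precubical := Precubical {
  cell :> nat -> Type;
  face : forall n : nat, 'I_n.+1 -> bool -> cell n.+1 -> cell n;
  (* delta_k delta_(l+1) = delta_l delta_k for k < l+1, so that both indices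
     range over 'I_n.+1 *)
  face_face : forall (n : nat) (k l : 'I_n.+1) (nu mu : bool) (x : cell n.+2),
    k <= l ->
    face k nu (face (lift ord0 l) mu x) =
    face l mu (face (widen_ord (leqnSn n.+1) k) nu x)
}.

Record hda := HDA { carrier :> precubical; pt : carrier 0 }.

Record hda_hom (X Y : hda) := HdaHom {
  hmap :> forall n : nat, X n -> Y n;
  hmap_face : forall (n : nat) (k : 'I_n.+1) (nu : bool) (x : X n.+1),
    hmap (face k nu x) = face k nu (hmap x);
  hmap_pt : hmap (pt X) = pt Y
}.

Definition cube (X : precubical) : Type := {n : nat & X n}.

Definition hmap_cube (X Y : hda) (f : hda_hom X Y) (x : cube X) : cube Y :=
  existT Y (tag x) (f (tag x) (tagged x)).

(* Faces of cubes of unspecified dimension; [None] if [k] is out of range. *)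
Definition cface (X : precubical) (k : nat) (nu : bool) (x : cube X) :
    option (cube X) :=
  match x with
  | existT 0 _ => None
  | existT n.+1 z =>
      omap (fun i : 'I_n.+1 => existT X n (face i nu z)) (insub k)
  end.

Definition is_face (X : precubical) (k : nat) (nu : bool) (x y : cube X) :
    Prop :=
  cface k nu y = Some x.

Definition step (X : precubical) (x y : cube X) : Prop :=
  exists k : nat, is_face k false x y \/ is_face k true y x.

Fixpoint cube_path (X : precubical) (s : seq (cube X)) : Prop :=
  match s with
  | x :: ((y :: _) as t) => step x y /\ cube_path t
  | _ => True
  end.

Definition cpt (X : hda) : cube X := existT X 0 (pt X).

Definition pointed_path (X : hda) (s : seq (cube X)) : Prop :=
  ohead s = Some (cpt X) /\ cube_path s.

(* delta_{k_1}^{nu_1} ... delta_{k_s}^{nu_s} x *)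
Definition ifaces (X : precubical) (ks : seq nat) (nus : seq bool)
    (x : cube X) : option (cube X) :=
  foldr (fun d : nat * bool => obind (cface d.1 d.2)) (Some x) (zip ks nus).

Section Homotopy.
Variable X : precubical.
Implicit Types a b u v : cube X.

(* The four elementary squares, for u = x_p, v = y_p and the common neighbours
   a = x_(p-1) = y_(p-1), b = x_(p+1) = y_(p+1).  In the first two, a (resp. b)
   is reached by both sides of delta_k delta_l = delta_(l-1) delta_k. *)
Definition adj_square (k l : nat) a u v b : Prop :=
  [\/ [/\ is_face k false a u, is_face l false u b,
          is_face l.-1 false a v & is_face k false v b],
      [/\ is_face k true u a, is_face l.-1 true b u,
          is_face l true v a & is_face k true b v],
      [/\ obind (cface k false) (cface l true v) = Some u,
          is_face k false a v & is_face l true b v]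
    | [/\ obind (cface k true) (cface l false v) = Some u,
          is_face l false a v & is_face k true b v]].

(* The paths agree except at one position, which is interior because adjacent
   paths have the same first and last cubes. *)
Definition adjacent (x y : seq (cube X)) : Prop :=
  [/\ cube_path x, cube_path y &
   exists s t a b u v,
    [/\ x = s ++ [:: a, u, b & t], y = s ++ [:: a, v, b & t], u <> v &
     exists k l, k < l /\ (adj_square k l a u v b \/ adj_square k l a v u b)]].

Definition homotopic : seq (cube X) -> seq (cube X) -> Prop :=
  clos_refl_trans _ adjacent.

End Homotopy.

(* n-cubes of the unfolding of X: homotopy classes of pointed cube paths that
   end in dimension n.  The common last cube [top] of the paths in the class
   [cls] is determined by [cls] (see [ucell_eq]); it is the image of the class
   under the projection from the unfolding to X. *)
Record ucell (X : hda) (n : nat) := UCell {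
  cls : set (seq (cube X));
  top : X n;
  clsP : exists p : seq (cube X),
    [/\ pointed_path p, last (cpt X) p = existT X n top &
        cls = [set q | homotopic p q]]
}.

Lemma upt_subproof (X : hda) : exists p : seq (cube X),
  [/\ pointed_path p, last (cpt X) p = existT X 0 (pt X) &
      [set q | homotopic [:: cpt X] q] = [set q | homotopic p q]].
Proof. by exists [:: cpt X]. Qed.

Definition upt (X : hda) : ucell X 0 := UCell (upt_subproof X).

(* The k-th lower or upper face of a homotopy class, as a set of cube paths. *)
Definition uface (X : hda) (n : nat) (k : 'I_n.+1) (nu : bool)
    (c : ucell X n.+1) : set (seq (cube X)) :=
  if nu then
    [set y | exists2 x, cls c x &
       homotopic (rcons x (existT X n (face k true (top c)))) y]
  else
    [set y | last (cpt X) y = existT X n (face k false (top c)) /\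
             cls c (rcons y (existT X n.+1 (top c)))].

(* Pointed precubical morphisms between unfoldings.  If X has a cube with two
   equal upper faces, say delta_1^1 y = delta_2^1 y, a set [uface k false c]
   may be a union of several homotopy classes.  Hence b is taken to be a face
   of c when [cls b `<=` uface k nu c].  Whenever [uface k nu c] is a homotopy
   class this means [cls b = uface k nu c] ([uface_uniq]), and [umap_face] says
   that the maps commute with the face maps ([umap_face_eq]). *)
Record unf_hom (X Y : hda) := UnfHom {
  umap :> forall n : nat, ucell X n -> ucell Y n;
  umap_face : forall (n : nat) (k : 'I_n.+1) (nu : bool)
      (b : ucell X n) (c : ucell X n.+1),
    cls b `<=` uface k nu c -> cls (umap b) `<=` uface k nu (umap c);
  umap_pt : umap (upt X) = upt Y
}.

Section UnfoldingFacts.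
Variable X : hda.

Lemma adjacent_sym (p q : seq (cube X)) : adjacent p q -> adjacent q p.
Proof.
move=> [cp cq [s [t [a [b [u [v [ep eq uv [k [l [kl sq]]]]]]]]]]].
split=> //; exists s, t, a, b, v, u; split=> //; first exact: nesym.
by exists k, l; split=> //; case: sq; [right | left].
Qed.

Lemma homotopic_sym (p q : seq (cube X)) : homotopic p q -> homotopic q p.
Proof.
elim=> [x y /adjacent_sym xy | x | x y z _ yx _ zy].
- exact: rt_step.
- exact: rt_refl.
- exact: rt_trans zy yx.
Qed.

Lemma homotopic_last (p q : seq (cube X)) :
  homotopic p q -> last (cpt X) p = last (cpt X) q.
Proof.
elim=> [x y [_ _ [s [t [a [b [u [v [-> -> _ _]]]]]]]] | x | x y z _ -> _ ->] //.
by rewrite !last_cat.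
Qed.

Lemma ucell_eq (n : nat) (b c : ucell X n) : cls b = cls c -> b = c.
Proof.
case: b c => [B x Bx] [C y Cy] /= eBC; case: C / eBC Cy => Cy.
suff exy : x = y by case: y / exy Cy => Cy; congr UCell; exact: Prop_irrelevance.
case: (Bx) (Cy) => [p [_ px ->]] [q [_ qy e]].
have pq : homotopic q p.
  have : [set r | homotopic p r] p by exact: rt_refl.
  by rewrite e.
apply: (Eqdep_dec.inj_pair2_eq_dec _ PeanoNat.Nat.eq_dec X n).
by rewrite -px -qy (homotopic_last pq).
Qed.

Lemma uface_uniq (n : nat) (k : 'I_n.+1) (nu : bool) (b b' : ucell X n)
    (c : ucell X n.+1) :
  cls b = uface k nu c -> cls b' `<=` uface k nu c -> b' = b.
Proof.
move=> <- sub; apply: ucell_eq.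
case: (clsP b) (clsP b') => [p [_ _ eb]] [p' [_ _ eb']].
have pp' : homotopic p p'.
  by move: (sub p'); rewrite eb eb' /=; apply; exact: rt_refl.
rewrite eb eb'; apply/seteqP; split=> q /= h; apply: rt_trans h => //.
exact: homotopic_sym.
Qed.

End UnfoldingFacts.

Lemma umap_face_eq (X Y : hda) (f : unf_hom X Y) (n : nat) (k : 'I_n.+1)
    (nu : bool) (b : ucell X n) (c : ucell X n.+1) (b' : ucell Y n) :
  cls b = uface k nu c -> cls b' = uface k nu (f _ c) -> f _ b = b'.
Proof.
move=> eb eb'; apply: (uface_uniq eb'); apply: umap_face.
by rewrite eb.
Qed.

(* Exactly one homotopy class of pointed cube paths to each cube, i.e. the
   projection [top] from the unfolding is bijective. *)
Definition tree (X : hda) : Prop :=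
  forall (n : nat) (x : X n), exists! c : ucell X n, top c = x.

Definition path_seq (P : hda) (p : seq (cube P)) : Prop :=
  [/\ pointed_path p, List.NoDup p &
   forall x : cube P, exists y : cube P, List.In y p /\
     exists nus : seq bool, exists! ks : seq nat,
       [/\ size ks = size nus, sorted ltn ks & ifaces ks nus y = Some x]].

(* The clause [path_seq] does not exclude cycles, e.g. the path (v, e) with
   both faces of the edge e equal to v; requiring P to be a tree does, and
   makes the projection from the unfolding of P invertible. *)
Definition path_object (P : hda) : Prop :=
  tree P /\ exists p : seq (cube P), path_seq p.

Definition path_extension (P Q : hda) (g : hda_hom P Q) : Prop :=
  exists p q, [/\ path_seq p, path_seq q &
    exists t, q = map (hmap_cube g) p ++ t].

Definition isomorphism (X Y : hda) (f : hda_hom X Y) : Prop :=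
  exists g : hda_hom Y X,
    (forall n x, g n (f n x) = x) /\ (forall n y, f n (g n y) = y).

Inductive hdp_hom : forall P Q : hda, hda_hom P Q -> Prop :=
| hdp_ext P Q (g : hda_hom P Q) :
    path_object P -> path_object Q -> path_extension g -> hdp_hom g
| hdp_iso P Q (g : hda_hom P Q) :
    path_object P -> path_object Q -> isomorphism g -> hdp_hom g
| hdp_comp P Q R (g : hda_hom P Q) (h : hda_hom Q R) (k : hda_hom P R) :
    hdp_hom g -> hdp_hom h -> (forall n x, k n x = h n (g n x)) -> hdp_hom k.

Definition open_map (X Y : hda) (f : hda_hom X Y) : Prop :=
  forall (P Q : hda) (g : hda_hom P Q) (p : hda_hom P X) (q : hda_hom Q Y),
    hdp_hom g -> (forall n x, f n (p n x) = q n (g n x)) ->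
    exists r : hda_hom Q X,
      (forall n x, r n (g n x) = p n x) /\ (forall n y, f n (r n y) = q n y).

Definition hd_bisimilar (X Y : hda) : Prop :=
  exists (Z : hda) (f : hda_hom Z X) (g : hda_hom Z Y),
    open_map f /\ open_map g.

(* [h] is the composite of the projection of P, a morphism [g] of path objects
   and the inverse of the (bijective) projection of Q. *)
Definition hdph_hom (P Q : hda) (h : unf_hom P Q) : Prop :=
  exists g : hda_hom P Q,
    hdp_hom g /\ forall n (c : ucell P n), top (h n c) = g n (top c).

Definition open_unf (X Y : hda) (f : unf_hom X Y) : Prop :=
  forall (P Q : hda) (h : unf_hom P Q) (p : unf_hom P X) (q : unf_hom Q Y),
    hdph_hom h -> (forall n c, f n (p n c) = q n (h n c)) ->
    exists r : unf_hom Q X,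
      (forall n c, r n (h n c) = p n c) /\ (forall n d, f n (r n d) = q n d).

Definition homotopy_bisimilar (X Y : hda) : Prop :=
  exists (Z : hda) (f : unf_hom Z X) (g : unf_hom Z Y),
    open_unf f /\ open_unf g.

(* Main.v *)
(* Only two facts about a path object are used: its projection from the
   unfolding is invertible, and a morphism between unfoldings is determined by
   its composite with the projection of the target (induction along paths).  So
   open morphisms of HDA induce open morphisms of HDA_h.  Conversely, let f be
   open from the unfolding of Z to the unfolding of X.  Since lower faces in the
   unfolding of Z need not be unique, the unfolding is replaced by the cofree
   precubical set W over it, whose n-cubes are the families that assign a cube
   of the unfolding to each iterated face of the standard n-cube.  Morphisms
   from any precubical set Q to W are the face-preserving maps from Q to the
   unfolding, and this makes W -> X open. *)
Require Import Defs.
From Stdlib Require Import Relation_Operators.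
From Stdlib Require Eqdep_dec PeanoNat.
From mathcomp Require Import all_boot.
From mathcomp Require Import boolp classical_sets.

Set Implicit Arguments.
Unset Strict Implicit.
Unset Printing Implicit Defensive.

Local Open Scope classical_set_scope.

(** * Cube paths and homotopy *)

Lemma cube_inj (X : precubical) (n : nat) (x y : X n) :
  existT X n x = existT X n y -> x = y.
Proof. exact: (Eqdep_dec.inj_pair2_eq_dec _ PeanoNat.Nat.eq_dec). Qed.

Lemma is_face_face (X : precubical) (n : nat) (k : 'I_n.+1) (nu : bool)
    (x : X n.+1) :
  is_face k nu (existT X n (face k nu x)) (existT X n.+1 x).
Proof. by rewrite /is_face /= valK. Qed.

Lemma is_faceP (X : precubical) (k : nat) (nu : bool) (x y : cube X) :
  is_face k nu x y -> exists n (i : 'I_n.+1) (z : X n.+1),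
    y = existT X n.+1 z /\ x = existT X n (face i nu z).
Proof.
case: y => [[|n] z] //; rewrite /is_face /=.
by case: insubP => //= i _ _ [<-]; exists n, i, z.
Qed.

Lemma cube_path_rcons (X : precubical) (a x : cube X) (p : seq (cube X)) :
  cube_path (rcons (a :: p) x) <-> cube_path (a :: p) /\ step (last a p) x.
Proof.
elim: p a => [|b p IH] a /=; first by split; case.
by move: (IH b) => /=; tauto.
Qed.

Lemma pointed_path_rcons (X : hda) (x : cube X) (p : seq (cube X)) :
  pointed_path p -> step (last (cpt X) p) x -> pointed_path (rcons p x).
Proof.
case: p => [|a p] [] //= ep cp st; split=> //=.
exact/(cube_path_rcons a x p).
Qed.

Lemma homotopic_pointed (X : hda) (p q : seq (cube X)) :
  homotopic p q -> pointed_path p -> pointed_path q.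
Proof.
elim=> [x y [_ cy [s [t [a [b [u [v [-> ey _ _]]]]]]]] [hx _]|//|];
  last by auto.
by split=> //; move: hx; rewrite ey; case: s {ey}.
Qed.

(** Appending a cube leaves the square of an adjacency interior, and homotopic paths end in the same
    cube, so the new step is legal on both. *)
Lemma homotopic_rcons (X : hda) (x : cube X) (p q : seq (cube X)) :
  pointed_path p -> step (last (cpt X) p) x -> homotopic p q ->
  homotopic (rcons p x) (rcons q x).
Proof.
move=> pp st pq; elim: pq pp st => {p q} [p q pq pp st|p _ _|p q r pq IH qr IH' pp st].
- have hpq := rt_step _ _ _ _ pq; apply: rt_step.
  have [_ cp] := pointed_path_rcons pp st.
  have st' : step (last (cpt X) q) x by rewrite -(homotopic_last hpq).
  have [_ cq] := pointed_path_rcons (homotopic_pointed hpq pp) st'.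
  case: pq => _ _ [s [t [a [b [u [v [ep eq uv sq]]]]]]].
  split=> //; exists s, (rcons t x), a, b, u, v; split=> //.
    by rewrite ep rcons_cat.
  by rewrite eq rcons_cat.
- exact: rt_refl.
- apply: rt_trans (IH pp st) _; apply: IH'; first exact: homotopic_pointed pq pp.
  by rewrite -(homotopic_last pq).
Qed.

(** * Homotopy classes as cubes of the unfolding *)

Section Classes.
Variables (X : hda) (n : nat).
Implicit Types (b c : ucell X n) (p q : seq (cube X)).

Lemma cls_nonempty c : exists p, cls c p.
Proof. by case: (clsP c) => p [_ _ ->]; exists p; exact: rt_refl. Qed.

Lemma cls_pointed c p : cls c p -> pointed_path p.
Proof. by case: (clsP c) => q [pq _ ->] /homotopic_pointed; apply. Qed.

Lemma cls_last c p : cls c p -> last (cpt X) p = existT X n (top c).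
Proof. by case: (clsP c) => q [_ <- ->] /homotopic_last. Qed.

Lemma cls_homotopic c p q : cls c p -> cls c q <-> homotopic p q.
Proof.
case: (clsP c) => r [_ _ ->] rp; split=> [rq | pq]; last exact: rt_trans rp pq.
exact: rt_trans (homotopic_sym rp) rq.
Qed.

Lemma cls_inj b c p : cls b p -> cls c p -> b = c.
Proof.
move=> bp cp; apply: ucell_eq; apply/seteqP; split=> q.
  by move/(cls_homotopic _ bp)/(cls_homotopic _ cp).
by move/(cls_homotopic _ cp)/(cls_homotopic _ bp).
Qed.

Lemma path_class p (x : X n) :
  pointed_path p -> last (cpt X) p = existT X n x ->
  exists2 c, cls c p & top c = x.
Proof.
move=> pp lp.
have P : exists q, [/\ pointed_path q, last (cpt X) q = existT X n x &
  [set r | homotopic p r] = [set r | homotopic q r]] by exists p.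
by exists (UCell P) => //; exact: rt_refl.
Qed.

End Classes.

(** * The face relation of the unfolding *)

Definition ucell_face (X : hda) (n : nat) (k : 'I_n.+1) (nu : bool)
    (b : ucell X n) (c : ucell X n.+1) : Prop :=
  cls b `<=` uface k nu c.

Lemma top_face (X : hda) (n : nat) (k : 'I_n.+1) (nu : bool)
    (b : ucell X n) (c : ucell X n.+1) :
  ucell_face k nu b c -> top b = face k nu (top c).
Proof.
have [p bp] := cls_nonempty b => /(_ p bp) h; apply: cube_inj.
rewrite -(cls_last bp); case: nu h => /= [[q _ /homotopic_last <-] | [//]].
by rewrite last_rcons.
Qed.

Lemma ucell_upper_face (X : hda) (n : nat) (k : 'I_n.+1) (b : ucell X n)
    (c : ucell X n.+1) p :
  cls c p -> cls b (rcons p (existT X n (face k true (top c)))) ->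
  ucell_face k true b c.
Proof.
by move=> cp bp q /(cls_homotopic _ bp) h; exists p.
Qed.

(** One path of [b] decides for all of [b], since appending the top of [c] respects homotopy. *)
Lemma ucell_lower_face (X : hda) (n : nat) (k : 'I_n.+1) (b : ucell X n)
    (c : ucell X n.+1) p :
  cls b p -> top b = face k false (top c) ->
  cls c (rcons p (existT X n.+1 (top c))) -> ucell_face k false b c.
Proof.
move=> bp tb cp q bq; split; first by rewrite (cls_last bq) tb.
apply/(cls_homotopic _ cp); apply: homotopic_rcons.
- exact: cls_pointed bp.
- by exists k; left; rewrite (cls_last bp) tb; exact: is_face_face.
- exact/(cls_homotopic _ bp).
Qed.

(** Paths in [c] are homotopic and remain so when the upper face is appended. Lower faces lack this:
    deleting the last cube of two homotopic paths need not leave homotopic ones. *)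
Lemma upper_face_uniq (X : hda) (n : nat) (k : 'I_n.+1) (b b' : ucell X n)
    (c : ucell X n.+1) :
  ucell_face k true b c -> ucell_face k true b' c -> b = b'.
Proof.
have [p bp] := cls_nonempty b; have [p' bp'] := cls_nonempty b'.
move=> /(_ p bp) [q cq h] /(_ p' bp') [q' cq' h'].
apply: (cls_inj (p := p') _ bp'); apply/(cls_homotopic _ bp).
apply: rt_trans (homotopic_sym h) _; apply: rt_trans h'.
apply: homotopic_rcons; first exact: cls_pointed cq.
  by exists k; right; rewrite (cls_last cq); exact: is_face_face.
exact/(cls_homotopic _ cq).
Qed.

(** Induction along a pointed path in the class: each step goes from a lower face up to its cube or
    from a cube down to an upper face. *)
Lemma ucell_ind (X : hda) (R : forall n, ucell X n -> Prop) :
  R 0 (upt X) ->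
  (forall n (k : 'I_n.+1) b c, ucell_face k false b c -> R n b -> R n.+1 c) ->
  (forall n (k : 'I_n.+1) b c, ucell_face k true b c -> R n.+1 c -> R n b) ->
  forall n c, R n c.
Proof.
move=> R0 Rup Rdown.
have H p : pointed_path p -> exists n (c : ucell X n), cls c p /\ R n c.
  elim/last_ind: p => [|p x IH] pp; first by case: pp.
  case: p IH pp => [|a p] IH pp.
    by exists 0, (upt X); split=> //; case: pp => -[->] _; exact: rt_refl.
  have [cp sx] : cube_path (a :: p) /\ step (last a p) x.
    by apply/cube_path_rcons; case: pp.
  have [|m [b [bp Rb]]] := IH; first by split=> //; case: pp.
  have lb := cls_last bp; case: sx => k [] /is_faceP [n [i [z [e1 e2]]]].
  - move: (etrans (esym lb) e2) => e.
    have em : m = n := congr1 tag e.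
    case: n / em i z e e1 {e2} => i z /cube_inj tb e1.
    have [c cx tc] := path_class pp (etrans (last_rcons _ _ _) e1).
    exists m.+1, c; split=> //; apply: Rup Rb => //.
    by apply: (ucell_lower_face (k := i) bp); rewrite tc // -e1.
  - move: (etrans (esym lb) e1) => e.
    have em : m = n.+1 := congr1 tag e; subst m.
    move/cube_inj: e => tb.
    have [c cx tc] := path_class pp (etrans (last_rcons _ _ _) e2).
    exists n, c; split=> //; apply: Rdown Rb.
    by apply: (ucell_upper_face (k := i) bp); rewrite tb -e2.
move=> n c; have [p cp] := cls_nonempty c.
have [m [b [bp Rb]]] := H p (cls_pointed cp).
have em : m = n := congr1 tag (etrans (esym (cls_last bp)) (cls_last cp)).
by subst m; rewrite (cls_inj cp bp).
Qed.

Lemma unf_hom_face (X Y : hda) (s : unf_hom X Y) (n : nat) (k : 'I_n.+1)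
    (nu : bool) (b : ucell X n) (c : ucell X n.+1) :
  ucell_face k nu b c -> ucell_face k nu (s n b) (s n.+1 c).
Proof. exact: umap_face. Qed.

(** Tops suffice because an upward step fixes the class above: it contains a path of the class below
    followed by its own top. A downward step fixes the class below by uniqueness of upper faces. *)
Lemma unf_hom_ext (P X : hda) (s t : unf_hom P X) :
  (forall n c, top (s n c) = top (t n c)) -> forall n c, s n c = t n c.
Proof.
move=> st; apply: ucell_ind => [|n k b c bc e|n k b c bc e].
- by rewrite !umap_pt.
- have [p sp] := cls_nonempty (s n b).
  have [_ h] := unf_hom_face (s := s) bc sp.
  rewrite e in sp; have [_ h'] := unf_hom_face (s := t) bc sp.
  by apply: (cls_inj h); rewrite st.
- apply: (upper_face_uniq (c := s n.+1 c)); first exact: unf_hom_face bc.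
  by rewrite e; exact: unf_hom_face bc.
Qed.

(** * Functoriality of the unfolding *)

Lemma is_face_hmap (X Y : hda) (f : hda_hom X Y) (k : nat) (nu : bool)
    (x y : cube X) :
  is_face k nu x y -> is_face k nu (hmap_cube f x) (hmap_cube f y).
Proof.
case: y => [[|n] z] //; rewrite /is_face /=.
by case: (insub k) => //= i [<-]; rewrite /hmap_cube /= hmap_face.
Qed.

Lemma cface2_hmap (X Y : hda) (f : hda_hom X Y) (k l : nat) (nu mu : bool)
    (x y : cube X) :
  obind (cface k nu) (cface l mu y) = Some x ->
  obind (cface k nu) (cface l mu (hmap_cube f y)) = Some (hmap_cube f x).
Proof.
case e : (cface l mu y) => [z|] // h.
have -> : cface l mu (hmap_cube f y) = Some (hmap_cube f z).
  exact: is_face_hmap e.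
exact: is_face_hmap h.
Qed.

Lemma cube_path_hmap (X Y : hda) (f : hda_hom X Y) (p : seq (cube X)) :
  cube_path p -> cube_path (map (hmap_cube f) p).
Proof.
elim: p => [|x [|y p] IH] //= [[k xy] /IH cp]; split=> //.
by exists k; case: xy => /(is_face_hmap f); [left | right].
Qed.

Lemma hmap_cpt (X Y : hda) (f : hda_hom X Y) : hmap_cube f (cpt X) = cpt Y.
Proof. by rewrite /hmap_cube /= hmap_pt. Qed.

Lemma pointed_path_hmap (X Y : hda) (f : hda_hom X Y) (p : seq (cube X)) :
  pointed_path p -> pointed_path (map (hmap_cube f) p).
Proof.
case=> hp cp; split; last exact: cube_path_hmap.
by case: p hp {cp} => //= a p [->]; rewrite hmap_cpt.
Qed.

Lemma last_hmap (X Y : hda) (f : hda_hom X Y) (p : seq (cube X)) :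
  last (cpt Y) (map (hmap_cube f) p) = hmap_cube f (last (cpt X) p).
Proof. by rewrite -(hmap_cpt f) last_map. Qed.

Lemma homotopic_hmap (X Y : hda) (f : hda_hom X Y) (p q : seq (cube X)) :
  homotopic p q -> homotopic (map (hmap_cube f) p) (map (hmap_cube f) q).
Proof.
have sq k l a u v b : adj_square k l a u v b ->
    adj_square k l (hmap_cube f a) (hmap_cube f u) (hmap_cube f v)
      (hmap_cube f b).
  by case=> [[*]|[*]|[*]|[*]]; [constructor 1|constructor 2|constructor 3|
    constructor 4]; split; by [exact: is_face_hmap | exact: cface2_hmap].
elim=> {p q} [p q | p | p q r _ pq _ qr]; last 2 first.
- exact: rt_refl.
- exact: rt_trans pq qr.
case=> /(cube_path_hmap f) cp /(cube_path_hmap f) cq.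
case=> s [t [a [b [u [v [ep eq _ [k [l [kl h]]]]]]]]].
(* f may identify u and v *)
have [e | ne] := pselect (hmap_cube f u = hmap_cube f v).
  by rewrite ep eq !map_cat /= e; exact: rt_refl.
apply: rt_step; split=> //.
exists (map (hmap_cube f) s), (map (hmap_cube f) t), (hmap_cube f a),
  (hmap_cube f b), (hmap_cube f u), (hmap_cube f v).
rewrite ep eq !map_cat; split=> //; exists k, l; split=> //.
by case: h => /sq; [left | right].
Qed.

Section UnfoldingMap.
Variables (X Y : hda) (f : hda_hom X Y).

(** The image of a class under [f] may be only part of a class, so it is closed under homotopy. *)
Lemma unf_cell_subproof (n : nat) (c : ucell X n) : exists p,
  [/\ pointed_path p, last (cpt Y) p = existT Y n (f n (top c)) &
      [set q | exists2 p, cls c p & homotopic (map (hmap_cube f) p) q] =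
      [set q | homotopic p q]].
Proof.
have [p cp] := cls_nonempty c; exists (map (hmap_cube f) p); split.
- exact: pointed_path_hmap (cls_pointed cp).
- by rewrite last_hmap (cls_last cp).
- apply/seteqP; split=> q /=; last by exists p.
  case=> p' /(cls_homotopic _ cp) /(homotopic_hmap f); exact: rt_trans.
Qed.

Definition unf_cell (n : nat) (c : ucell X n) : ucell Y n :=
  UCell (unf_cell_subproof c).

Lemma cls_unf_cell (n : nat) (c : ucell X n) p :
  cls c p -> cls (unf_cell c) (map (hmap_cube f) p).
Proof. by exists p => //; exact: rt_refl. Qed.

Lemma unf_cell_face (n : nat) (k : 'I_n.+1) (nu : bool)
    (b : ucell X n) (c : ucell X n.+1) :
  ucell_face k nu b c -> ucell_face k nu (unf_cell b) (unf_cell c).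
Proof.
have [p bp] := cls_nonempty b => bc; move: (bc p bp) (top_face bc).
case: nu {bc} => /= [[q cq h] _|[lp h] tb].
- apply: (ucell_upper_face (cls_unf_cell cq)).
  apply/(cls_homotopic _ (cls_unf_cell bp)); apply: homotopic_sym.
  move/(homotopic_hmap f): h.
  by rewrite map_rcons /hmap_cube /= hmap_face.
- apply: (ucell_lower_face (cls_unf_cell bp)); first by rewrite /= tb hmap_face.
  by move/cls_unf_cell: h; rewrite map_rcons.
Qed.

Lemma unf_cell_pt : unf_cell (upt X) = upt Y.
Proof.
apply: (cls_inj (p := [:: cpt Y])); last exact: rt_refl.
exists [:: cpt X]; first exact: rt_refl.
by rewrite /= hmap_cpt; exact: rt_refl.
Qed.

Definition unf_map : unf_hom X Y := UnfHom unf_cell_face unf_cell_pt.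

End UnfoldingMap.

Lemma unf_comp_face (X Y Z : hda) (g : unf_hom Y Z) (f : unf_hom X Y)
    (n : nat) (k : 'I_n.+1) (nu : bool) (b : ucell X n) (c : ucell X n.+1) :
  ucell_face k nu b c -> ucell_face k nu (g n (f n b)) (g n.+1 (f n.+1 c)).
Proof. by move=> bc; do 2 apply: unf_hom_face. Qed.

Lemma unf_comp_pt (X Y Z : hda) (g : unf_hom Y Z) (f : unf_hom X Y) :
  g 0 (f 0 (upt X)) = upt Z.
Proof. by rewrite !umap_pt. Qed.

Definition unf_comp (X Y Z : hda) (g : unf_hom Y Z) (f : unf_hom X Y) :
  unf_hom X Z := UnfHom (@unf_comp_face X Y Z g f) (unf_comp_pt g f).

Lemma hda_comp_face (X Y Z : hda) (g : hda_hom Y Z) (f : hda_hom X Y)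
    (n : nat) (k : 'I_n.+1) (nu : bool) (x : X n.+1) :
  g n (f n (face k nu x)) = face k nu (g n.+1 (f n.+1 x)).
Proof. by rewrite !hmap_face. Qed.

Lemma hda_comp_pt (X Y Z : hda) (g : hda_hom Y Z) (f : hda_hom X Y) :
  g 0 (f 0 (pt X)) = pt Z.
Proof. by rewrite !hmap_pt. Qed.

Definition hda_comp (X Y Z : hda) (g : hda_hom Y Z) (f : hda_hom X Y) :
  hda_hom X Z :=
  @HdaHom X Z (fun n x => g n (f n x)) (@hda_comp_face X Y Z g f) (hda_comp_pt g f).

(** * Trees and the inverse of their projection *)

Section TreeSection.
Variables (P : hda) (treeP : tree P).

Definition sect (n : nat) (x : P n) : ucell P n := sval (cid (treeP x)).

Lemma top_sect (n : nat) (x : P n) : top (sect x) = x.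
Proof. by rewrite /sect; case: cid => c []. Qed.

Lemma sect_uniq (n : nat) (c : ucell P n) (x : P n) : top c = x -> sect x = c.
Proof. by rewrite /sect; case: cid => d [] /= _; apply. Qed.

(** A path to [x] extends to an upper face, and a path to a lower face extends to [x]. In a tree the
    class of the extended path is forced to be the value of [sect]. *)
Lemma sect_face (n : nat) (k : 'I_n.+1) (nu : bool) (x : P n.+1) :
  ucell_face k nu (sect (face k nu x)) (sect x).
Proof.
case: nu.
- have [p cp] := cls_nonempty (sect x).
  have lp := cls_last cp; rewrite top_sect in lp.
  have [|b bp tb] := path_class (p := rcons p (existT P n (face k true x)))
    (x := face k true x) _ (last_rcons _ _ _).
    apply: pointed_path_rcons; first exact: cls_pointed cp.
    by exists k; right; rewrite lp; exact: is_face_face.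
  by rewrite (sect_uniq tb); apply: (ucell_upper_face cp); rewrite top_sect.
- have [p bp] := cls_nonempty (sect (face k false x)).
  have lp := cls_last bp; rewrite top_sect in lp.
  have [|c cp tc] := path_class (p := rcons p (existT P n.+1 x))
    (x := x) _ (last_rcons _ _ _).
    apply: pointed_path_rcons; first exact: cls_pointed bp.
    by exists k; left; rewrite lp; exact: is_face_face.
  rewrite (sect_uniq tc).
  by apply: (ucell_lower_face bp); rewrite ?top_sect tc.
Qed.

Lemma sect_pt : sect (pt P) = upt P.
Proof. exact: sect_uniq. Qed.

Variables (X : hda) (s : unf_hom P X).

Lemma tree_hom_face (n : nat) (k : 'I_n.+1) (nu : bool) (x : P n.+1) :
  top (s n (sect (face k nu x))) = face k nu (top (s n.+1 (sect x))).
Proof. by apply: top_face; apply: unf_hom_face; exact: sect_face. Qed.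

Lemma tree_hom_pt : top (s 0 (sect (pt P))) = pt X.
Proof. by rewrite sect_pt umap_pt. Qed.

Definition tree_hom : hda_hom P X :=
  @HdaHom P X (fun n x => top (s n (sect x))) tree_hom_face tree_hom_pt.

Lemma top_tree_hom (n : nat) (c : ucell P n) : tree_hom n (top c) = top (s n c).
Proof. by rewrite /= (sect_uniq (erefl (top c))). Qed.

End TreeSection.

(** * Open morphisms of HDA unfold to open morphisms *)

Lemma hdp_hom_tree (P Q : hda) (g : hda_hom P Q) :
  hdp_hom g -> tree P /\ tree Q.
Proof.
by elim=> {P Q g} [P Q g [] tP _ [] tQ _ _|P Q g [] tP _ [] tQ _ _|
  P Q R g h k _ [tP _] _ [_ tR] _].
Qed.

(** A square over [unf_map f] descends along [tree_hom] to a square over [f]. A lift [r] there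
    unfolds to [unf_map r], and both triangles need only be checked after projection. *)
Lemma open_unf_map (X Y : hda) (f : hda_hom X Y) :
  open_map f -> open_unf (unf_map f).
Proof.
move=> openf P Q h p q [g [gP hg]] fp; have [tP tQ] := hdp_hom_tree gP.
have [n x|r [rg fr]] := openf _ _ g (tree_hom tP p) (tree_hom tQ q) gP.
  have := congr1 (@top _ _) (fp n (sect tP x)); rewrite /= => ->.
  by rewrite -top_tree_hom hg top_sect.
exists (unf_map r); split.
- apply: (@unf_hom_ext _ _ (unf_comp (unf_map r) h) p) => n c /=.
  by rewrite hg rg top_tree_hom.
- apply: (@unf_hom_ext _ _ (unf_comp (unf_map f) (unf_map r)) q) => n c /=.
  by rewrite fr top_tree_hom.
Qed.

(** * Iterated faces of the standard cube *)

(* [word n m] consists of the formal (n-m)-fold iterated faces of an n-cube;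
   the last face to be taken is at the head. *)
Inductive word (n : nat) : nat -> Type :=
| wnil : word n n
| wcons m : 'I_m.+1 -> bool -> word n m.+1 -> word n m.

(** One use of the precubical identity at any place in a word. No equivalence closure is taken, as
    the relation only serves to force equal values. *)
Inductive weq (n : nat) : forall m, word n m -> word n m -> Prop :=
| weq_swap m (k l : 'I_m.+1) (nu mu : bool) (w : word n m.+2) : k <= l ->
    weq (wcons k nu (wcons (lift ord0 l) mu w))
        (wcons l mu (wcons (widen_ord (leqnSn m.+1) k) nu w))
| weq_cons m (k : 'I_m.+1) (nu : bool) (v w : word n m.+1) :
    weq v w -> weq (wcons k nu v) (wcons k nu w).

(** The new face goes to the far end and is taken first: this is the inclusion of the standard
    n-cube as a face of the (n+1)-cube. *)
Fixpoint wface (n : nat) (k : 'I_n.+1) (nu : bool) (m : nat) (w : word n m) :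
    word n.+1 m :=
  match w with
  | wnil => wcons k nu (wnil n.+1)
  | wcons _ l mu v => wcons l mu (wface k nu v)
  end.

Fixpoint wact (Q : precubical) (n : nat) (x : Q n) (m : nat) (w : word n m) :
    Q m :=
  match w with
  | wnil => x
  | wcons _ k nu v => face k nu (wact x v)
  end.

Lemma weq_wface (n : nat) (k : 'I_n.+1) (nu : bool) (m : nat) (v w : word n m) :
  weq v w -> weq (wface k nu v) (wface k nu w).
Proof. by elim=> /= *; [exact: weq_swap | exact: weq_cons]. Qed.

Lemma weq_wface2 (n : nat) (k l : 'I_n.+1) (nu mu : bool) (m : nat)
    (w : word n m) : k <= l ->
  weq (wface (lift ord0 l) mu (wface k nu w))
      (wface (widen_ord (leqnSn n.+1) k) nu (wface l mu w)).
Proof. by move=> kl; elim: w => /= *; [exact: weq_swap | exact: weq_cons]. Qed.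

Lemma wact_weq (Q : precubical) (n : nat) (x : Q n) (m : nat) (v w : word n m) :
  weq v w -> wact x v = wact x w.
Proof. by elim=> /= [*|? ? ? ? ? _ ->] //; exact: face_face. Qed.

Lemma wact_wface (Q : precubical) (n : nat) (k : 'I_n.+1) (nu : bool)
    (x : Q n.+1) (m : nat) (w : word n m) :
  wact x (wface k nu w) = wact (face k nu x) w.
Proof. by elim: w => //= ? ? ? ? ->. Qed.

Fixpoint wcomp (n m : nat) (w : word n m) (l : nat) (v : word m l) : word n l :=
  match v with
  | wnil => w
  | wcons _ k nu u => wcons k nu (wcomp w u)
  end.

Lemma wcomp_wface (n m : nat) (w : word n m.+1) (k : 'I_m.+1) (nu : bool)
    (l : nat) (v : word m l) :
  wcomp w (wface k nu v) = wcomp (wcons k nu w) v.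
Proof. by elim: v => //= ? ? ? ? ->. Qed.

Lemma word_le (n m : nat) (w : word n m) : m <= n.
Proof. by elim: w => // ? ? ? _ /ltnW. Qed.

(** * The cofree precubical set over an unfolding *)

Section Cofree.
Variable Z : hda.

(** Words modulo the equivalence generated by [weq] are the cells of the standard n-cube, so a
    family is a face-preserving map from that cube to the unfolding. It records a coherent choice of
    lower faces. *)
Record family (n : nat) := Family {
  fam :> forall m, word n m -> ucell Z m;
  fam_face : forall m (k : 'I_m.+1) (nu : bool) (w : word n m.+1),
    ucell_face k nu (fam (wcons k nu w)) (fam w);
  fam_weq : forall m (v w : word n m), weq v w -> fam v = fam w
}.

Lemma family_ext (n : nat) (F G : family n) :
  (forall m (w : word n m), F m w = G m w) -> F = G.
Proof.
case: F G => F F1 F2 [G G1 G2] /= FG.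
have e : F = G by apply: functional_extensionality_dep => m; apply/funext.
by case: G / e G1 G2 {FG} => G1 G2; congr Family; exact: Prop_irrelevance.
Qed.

(** Restriction along the inclusion of a face: an operation even where lower faces in the unfolding
    are ambiguous. *)
Definition family_wface (n : nat) (k : 'I_n.+1) (nu : bool) (F : family n.+1) :
  family n.
Proof.
exists (fun m w => F m (wface k nu w)) => [m l mu w|m v w vw].
- exact: fam_face.
- by apply: fam_weq; exact: weq_wface.
Defined.

Lemma family_wface2 (n : nat) (k l : 'I_n.+1) (nu mu : bool) (F : family n.+2) :
  k <= l ->
  family_wface k nu (family_wface (lift ord0 l) mu F) =
  family_wface l mu (family_wface (widen_ord (leqnSn n.+1) k) nu F).
Proof. by move=> kl; apply: family_ext => m w /=; apply/fam_weq/weq_wface2. Qed.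

Definition family_pt : family 0.
Proof.
exists (fun m => match m return word 0 m -> ucell Z m with
  | 0 => fun _ => upt Z
  (* No word leads from dimension 0 to a positive dimension. *)
  | m.+1 => fun w => match notF (word_le w) with end
  end) => [m k nu w|[|m] v w _] //.
- by have := word_le w.
- by have := word_le w.
Defined.

Definition cofree : hda := @HDA (Precubical family_wface2) family_pt.

Definition counit (n : nat) (F : cofree n) : ucell Z n := fam F (wnil n).

Lemma counit_face (n : nat) (k : 'I_n.+1) (nu : bool) (F : cofree n.+1) :
  ucell_face k nu (counit (face k nu F)) (counit F).
Proof. exact: fam_face. Qed.

(** For empty [v] this recovers the whole family from the counits of its iterated faces. *)
Lemma fam_wact (n : nat) (F : cofree n) (m : nat) (w : word n m) (l : nat)
    (v : word m l) :
  fam (wact F w) v = fam F (wcomp w v).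
Proof.
elim: w l v => [|{}m k nu w IH] l v /=; last by rewrite IH wcomp_wface.
by congr (fam F); elim: v => //= ? ? ? ? <-.
Qed.

(** Uniqueness in the universal property: the value of a family at [w] is the counit of its iterated
    face along [w], and morphisms commute with iterated faces. *)
Lemma cofree_hom_ext (P : hda) (p q : hda_hom P cofree) :
  (forall n x, counit (p n x) = counit (q n x)) -> forall n x, p n x = q n x.
Proof.
have wact_hom (r : hda_hom P cofree) n x m (w : word n m) :
    r m (wact x w) = wact (r n x) w.
  by elim: w => //= ? ? ? ? <-; rewrite hmap_face.
move=> pq n x; apply: family_ext => m w.
by have := pq m (wact x w); rewrite !wact_hom /counit !fam_wact.
Qed.

Section Lift.
Variables (Q : hda) (treeQ : tree Q) (s : unf_hom Q Z).

(** Existence in the universal property, for a tree [Q]: a word is sent to the value of [s] over the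
    corresponding iterated face of [x]. *)
Definition cofree_lift_cell (n : nat) (x : Q n) : family n.
Proof.
exists (fun m w => s m (sect treeQ (wact x w))) => [m k nu w|m v w vw].
- by apply: unf_hom_face; exact: sect_face.
- by rewrite (wact_weq x vw).
Defined.

Lemma cofree_lift_face (n : nat) (k : 'I_n.+1) (nu : bool) (x : Q n.+1) :
  cofree_lift_cell (face k nu x) = family_wface k nu (cofree_lift_cell x).
Proof. by apply: family_ext => m w; rewrite /= wact_wface. Qed.

Lemma cofree_lift_pt : cofree_lift_cell (pt Q) = family_pt.
Proof.
apply: family_ext => m w; case: m / w => [|m k nu w] /=.
  by rewrite sect_pt umap_pt.
by have := word_le w.
Qed.

Definition cofree_lift : hda_hom Q cofree :=
  @HdaHom Q cofree cofree_lift_cell cofree_lift_face cofree_lift_pt.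

End Lift.

Section Projection.
Variables (X : hda) (f : unf_hom Z X).

Definition cofree_proj_cell (n : nat) (F : cofree n) : X n :=
  top (f n (counit F)).

(** A face relation in an unfolding becomes an equation after projection, so the ambiguity of lower
    faces disappears in [X]. *)
Lemma cofree_proj_face (n : nat) (k : 'I_n.+1) (nu : bool) (F : cofree n.+1) :
  cofree_proj_cell (face k nu F) = face k nu (cofree_proj_cell F).
Proof. by apply: top_face; apply: unf_hom_face; exact: counit_face. Qed.

Lemma cofree_proj_pt : cofree_proj_cell (pt cofree) = pt X.
Proof. by rewrite /cofree_proj_cell /counit /= umap_pt. Qed.

Definition cofree_proj : hda_hom cofree X :=
  @HdaHom cofree X cofree_proj_cell cofree_proj_face cofree_proj_pt.

End Projection.

Section Transpose.
Variables (P : hda) (p : hda_hom P cofree).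

Lemma transpose_face (n : nat) (k : 'I_n.+1) (nu : bool)
    (b : ucell P n) (c : ucell P n.+1) :
  ucell_face k nu b c ->
  ucell_face k nu (counit (p n (top b))) (counit (p n.+1 (top c))).
Proof. by move/top_face=> ->; rewrite hmap_face; exact: counit_face. Qed.

Lemma transpose_pt : counit (p 0 (top (upt P))) = upt Z.
Proof. by rewrite /= hmap_pt. Qed.

Definition transpose : unf_hom P Z := UnfHom transpose_face transpose_pt.

End Transpose.

(** Transposition turns a square over [cofree_proj f] into one over [f], whose lift [r] is carried
    back by [cofree_lift]. The triangle under [P] is checked on counits, the one over [X] by
    projecting. *)
Lemma open_cofree_proj (X : hda) (f : unf_hom Z X) :
  open_unf f -> open_map (cofree_proj f).
Proof.
move=> openf P Q g p q gP fp; have [tP tQ] := hdp_hom_tree gP.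
have [||r [rg fr]] := openf _ _ (unf_map g) (transpose p) (unf_map q).
- by exists g.
- apply: (@unf_hom_ext _ _ (unf_comp f (transpose p))
    (unf_comp (unf_map q) (unf_map g))) => n c.
  exact: fp.
(* [cofree_lift] undoes transposition: its counit is [r] again. *)
have lift n c : counit (cofree_lift tQ r n (top c)) = r n c.
  by rewrite /counit /= (sect_uniq tQ (erefl (top c))).
exists (cofree_lift tQ r); split=> [n x|n y].
- apply: (cofree_hom_ext (p := hda_comp (cofree_lift tQ r) g)) => {}n {}x.
  (* The class over [g n x] is taken as the image of the class over [x], so that [rg] applies. *)
  have := lift n (unf_map g n (sect tP x)); rewrite rg /= top_sect.
  by apply.
- have := fr n (sect tQ y); rewrite -lift top_sect => /(congr1 (@top _ _)).
  by rewrite /= top_sect.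
Qed.

End Cofree.

Theorem theorem6p6 (X Y : hda) : homotopy_bisimilar X Y <-> hd_bisimilar X Y.
Proof.
split=> [[Z [f [g [openf openg]]]]|[Z [f [g [openf openg]]]]].
(* The cofree set depends on [Z] alone, so one apex serves both legs. *)
- exists (cofree Z), (cofree_proj f), (cofree_proj g).
  by split; exact: open_cofree_proj.
- by exists Z, (unf_map f), (unf_map g); split; exact: open_unf_map.
Qed.
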